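(* Let $p$ be an odd prime and let $r\geq 1$ be an integer. Suppose that $\alpha\in\mathbb{Z}_p$ and $\alpha\equiv 2a\pmod p$ for some integer $a$ with $1\leq a<(p+r)/(2r+1)$. Then $${}_{2r+1}F_{2r}\bigg[\begin{matrix}\alpha&\alpha&\ldots&\alpha\\ &1&\ldots&1\end{matrix}\bigg|\,1\bigg]_{p-1}\equiv 0\pmod{p^2},$$ that is, $\displaystyle\sum_{k=0}^{p-1}\frac{(\alpha)_k^{2r+1}}{(1)_k^{2r+1}}\in p^2\mathbb{Z}_p$.
   Context: $\mathbb{Z}_p$ is the ring of $p$-adic integers, and congruences are in $\mathbb{Z}_p$. The rising factorial is $(x)_0=1$ and $(x)_k=x(x+1)\cdots(x+k-1)$ for $k\geq 1$; in particular $(1)_k=k!$. The truncated hypergeometric series is $${}_{q+1}F_{q}\bigg[\begin{matrix}x_0&x_1&\ldots&x_{q}\\ &y_1&\ldots&y_q\end{matrix}\bigg|\,z\bigg]_{n}=\sum_{k=0}^n\frac{(x_0)_k(x_1)_k\cdots(x_q)_k}{(y_1)_k\cdots (y_q)_k}\cdot\frac{z^k}{k!}.$$ In the claim there are $2r+1$ upper parameters all equal to $\alpha$ and $2r$ lower parameters all equal to $1$. *)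

(* Defs.v *)
From HB Require Import structures.
From mathcomp Require Import all_boot all_order all_algebra.
From mathcomp Require Import boolp.
Set Implicit Arguments.
Unset Strict Implicit.
Unset Printing Implicit Defensive.
Import Order.TTheory GRing.Theory Num.Theory.
Local Open Scope ring_scope.

(* The ring of p-adic integers, as the inverse limit of the rings Z/p^(n+1);
   [x n] is the residue of x modulo p^(n+1).  The index is shifted because
   'Z_1 denotes Z/2.  For p = 0 and p = 1 the definition makes sense but
   degenerates to Z/2; [padic p] is meant to be used with p > 1. *)
Record padic (p : nat) := Padic {
  padic_val :> forall n, 'Z_(p ^ n.+1);
  padic_valP : forall n, (val (padic_val n.+1))%:R = padic_val n
}.

Lemma padicP (p : nat) (x y : padic p) : (forall n, x n = y n) -> x = y.
Proof.
case: x => x hx; case: y => y hy /= xy.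
have {}xy : x = y by apply: functional_extensionality_dep.
by subst y; congr Padic; exact: Prop_irrelevance.
Qed.

Lemma padic_dvdn (p n : nat) :
  ((Zp_trunc (p ^ n.+1)).+2 %| (Zp_trunc (p ^ n.+2)).+2)%N.
Proof.
case: p => [|[|p]]; first by rewrite !exp0n.
  by rewrite !exp1n.
by rewrite !Zp_cast ?ltn_exp2l // -?[1%N in X in (X < _)%N](expn0 p.+2)
  ?ltn_exp2l // dvdn_exp2l.
Qed.

Lemma padic_natr_mod (p n k : nat) :
  ((k %% (Zp_trunc (p ^ n.+2)).+2)%N)%:R = k%:R :> 'Z_(p ^ n.+1).
Proof.
by apply: val_inj; rewrite !Zp_nat /= modn_dvdm // padic_dvdn.
Qed.

Lemma padic_zero_subproof (p n : nat) :
  (val (0 : 'Z_(p ^ n.+2)))%:R = 0 :> 'Z_(p ^ n.+1).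
Proof. by []. Qed.

Lemma padic_one_subproof (p n : nat) :
  (val (1 : 'Z_(p ^ n.+2)))%:R = 1 :> 'Z_(p ^ n.+1).
Proof. by rewrite /= padic_natr_mod. Qed.

Lemma padic_add_subproof (p : nat) (x y : padic p) (n : nat) :
  (val (x n.+1 + y n.+1))%:R = x n + y n.
Proof.
rewrite -(padic_valP x n) -(padic_valP y n) -natrD -[RHS]padic_natr_mod.
by [].
Qed.

Lemma padic_opp_subproof (p : nat) (x : padic p) (n : nat) :
  (val (- x n.+1))%:R = - x n.
Proof.
apply/eqP; rewrite -subr_eq0 opprK -(padic_valP x n) -natrD.
rewrite -[X in X == _]padic_natr_mod.
by have /(congr1 val)/= -> := addNr (x n.+1).
Qed.

Lemma padic_mul_subproof (p : nat) (x y : padic p) (n : nat) :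
  (val (x n.+1 * y n.+1))%:R = x n * y n.
Proof.
rewrite -(padic_valP x n) -(padic_valP y n) -natrM -[RHS]padic_natr_mod.
by [].
Qed.

Definition padic_zero (p : nat) : padic p := Padic (@padic_zero_subproof p).
Definition padic_one (p : nat) : padic p := Padic (@padic_one_subproof p).
Definition padic_add (p : nat) (x y : padic p) : padic p :=
  Padic (padic_add_subproof x y).
Definition padic_opp (p : nat) (x : padic p) : padic p :=
  Padic (padic_opp_subproof x).
Definition padic_mul (p : nat) (x y : padic p) : padic p :=
  Padic (padic_mul_subproof x y).

Definition padic_unit (p : nat) : {pred padic p} :=
  fun x => `[< forall n, x n \is a GRing.unit >].

Lemma padic_inv_subproof (p : nat) (x : padic p) :
  (forall n, x n \is a GRing.unit) ->
  forall n, (val (x n.+1)^-1)%:R = (x n)^-1.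
Proof.
move=> ux n; apply: (mulIr (ux n)); rewrite (mulVr (ux n)).
rewrite -(padic_valP x n) -natrM -[LHS]padic_natr_mod.
have /(congr1 val)/= -> := mulVr (ux n.+1).
by rewrite padic_natr_mod.
Qed.

(* As for every [unitRingType], the inverse of a non-unit is itself. *)
Definition padic_inv (p : nat) (x : padic p) : padic p :=
  match pselect (forall n, x n \is a GRing.unit) with
  | left ux => Padic (padic_inv_subproof ux)
  | right _ => x
  end.

HB.instance Definition _ (p : nat) := gen_eqMixin (padic p).
HB.instance Definition _ (p : nat) := gen_choiceMixin (padic p).

Lemma padic_addA (p : nat) : associative (@padic_add p).
Proof. by move=> x y z; apply: padicP => n; exact: addrA. Qed.
Lemma padic_addC (p : nat) : commutative (@padic_add p).
Proof. by move=> x y; apply: padicP => n; exact: addrC. Qed.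
Lemma padic_add0 (p : nat) : left_id (padic_zero p) (@padic_add p).
Proof. by move=> x; apply: padicP => n; exact: add0r. Qed.
Lemma padic_addN (p : nat) :
  left_inverse (padic_zero p) (@padic_opp p) (@padic_add p).
Proof. by move=> x; apply: padicP => n; exact: addNr. Qed.

HB.instance Definition _ (p : nat) := GRing.isZmodule.Build (padic p)
  (@padic_addA p) (@padic_addC p) (@padic_add0 p) (@padic_addN p).

Lemma padic_mulA (p : nat) : associative (@padic_mul p).
Proof. by move=> x y z; apply: padicP => n; exact: mulrA. Qed.
Lemma padic_mulC (p : nat) : commutative (@padic_mul p).
Proof. by move=> x y; apply: padicP => n; exact: mulrC. Qed.
Lemma padic_mul1 (p : nat) : left_id (padic_one p) (@padic_mul p).
Proof. by move=> x; apply: padicP => n; exact: mul1r. Qed.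
Lemma padic_mulD (p : nat) :
  left_distributive (@padic_mul p) (@padic_add p).
Proof. by move=> x y z; apply: padicP => n; exact: mulrDl. Qed.
Lemma padic_one_neq0 (p : nat) : padic_one p != 0.
Proof.
by apply/eqP => /(congr1 (fun x : padic p => x 0%N))/eqP; rewrite oner_eq0.
Qed.

HB.instance Definition _ (p : nat) := GRing.Zmodule_isComNzRing.Build (padic p)
  (@padic_mulA p) (@padic_mulC p) (@padic_mul1 p) (@padic_mulD p)
  (@padic_one_neq0 p).

Lemma padic_mulV (p : nat) :
  {in @padic_unit p, left_inverse 1 (@padic_inv p) *%R}.
Proof.
move=> x /asboolP ux; rewrite /padic_inv; case: pselect => // {}ux.
by apply: padicP => n; exact: (mulVr (ux n)).
Qed.
Lemma padic_unitP (p : nat) (x y : padic p) : y * x = 1 -> padic_unit x.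
Proof.
move=> yx; apply/asboolP => n; apply/unitrPr; exists (y n).
by rewrite mulrC; exact: (congr1 (fun z : padic p => z n) yx).
Qed.
Lemma padic_inv_out (p : nat) :
  {in [predC @padic_unit p], @padic_inv p =1 id}.
Proof.
move=> x; rewrite inE /= => /negP nux.
rewrite /padic_inv; case: pselect => // ux.
by case: nux; apply/asboolP.
Qed.

HB.instance Definition _ (p : nat) :=
  GRing.ComNzRing_hasMulInverse.Build (padic p)
    (@padic_mulV p) (@padic_unitP p) (@padic_inv_out p).

Lemma padic_natrE (p k n : nat) : (k%:R : padic p) n = k%:R.
Proof.
by elim: k => // k IHk; rewrite -!natr1 -IHk.
Qed.

Lemma padic_natr_unit (p k : nat) :
  prime p -> coprime p k -> (k%:R : padic p) \is a GRing.unit.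
Proof.
move=> pp pk; apply/asboolP => n; rewrite padic_natrE unitZpE ?coprimeXl //.
by rewrite -(exp1n n.+1) ltn_exp2r // prime_gt1.
Qed.

(* The denominators occurring in the truncated series below are invertible. *)
Lemma padic_fact_unit (p k : nat) :
  prime p -> (k < p)%N -> (k`!%:R : padic p) \is a GRing.unit.
Proof.
move=> pp; elim: k => [|k IHk] kp; first by rewrite unitr1.
rewrite factS natrM unitrM IHk ?(ltnW kp) // andbT padic_natr_unit //.
by rewrite prime_coprime // gtnNdvd.
Qed.

Definition cong_mod (R : comNzRingType) (m x y : R) : Prop :=
  exists c : R, x - y = m * c.

Definition rising (R : pzRingType) (x : R) (k : nat) : R :=
  \prod_(0 <= i < k) (x + i%:R).

(* The truncated hypergeometric series with upper parameters x_0, ..., x_q and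
   lower parameters y_1, ..., y_q (indexed from 0 here), summed over k <= n.
   It is meaningful when the (y_i)_k and k! are units for k <= n. *)
Definition hypergeom (R : comUnitRingType) (q : nat) (x : 'I_q.+1 -> R)
    (y : 'I_q -> R) (z : R) (n : nat) : R :=
  \sum_(0 <= k < n.+1)
    (\prod_i rising (x i) k) / (\prod_i rising (y i) k) * (z ^+ k / k`!%:R).

Lemma rising1 (R : pzRingType) (k : nat) : rising (1 : R) k = k`!%:R.
Proof.
rewrite /rising; elim: k => [|k IHk]; first by rewrite big_nil.
by rewrite big_nat_recr //= IHk factS mulnC natrM -nat1r.
Qed.

Lemma hypergeom_const (R : comUnitRingType) (q : nat) (x : R) (n : nat) :
  hypergeom (fun _ : 'I_q.+1 => x) (fun _ : 'I_q => 1) 1 n =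
  \sum_(0 <= k < n.+1) rising x k ^+ q.+1 / rising 1 k ^+ q.+1.
Proof.
apply: eq_big_nat => k _; rewrite expr1n !prodr_const !card_ord !rising1 div1r.
by rewrite -mulrA -!exprVn -exprSr.
Qed.

(* Main.v *)
(* Write m = 2r+1, alpha = 2a + pt and F(X) = sum_(k<p) ((2a + X)_k / k!)^m.
   Modulo p^2, F(pt) is affine in t, so two values of t suffice.
   For t = -1, (2a - p)_k / k! = (-1)^k C(p-2a, k), and since p - 2a and m are
   odd the sum vanishes by the symmetry k -> p - 2a - k.
   For t = 0, (2a)_k / k! = C(k+2a-1, k) is, up to the factor (2a-1)!, the
   polynomial (k+1)...(k+2a-1), whose m-th power G satisfies G(-2a-x) = -G(x).
   Hence the sums of G over 0 <= k < p and over -p <= k < 0 cancel mod p^2, and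
   Taylor expansion in the shift by p gives 2 sum G(k) = p sum G'(k) mod p^2.
   The bound on a says deg G <= 2p - 3, which makes sum G'(k) divisible by p. *)
Require Import Defs.
From mathcomp Require Import all_boot all_order all_algebra.
From mathcomp Require Import zify ring.
Set Implicit Arguments.
Unset Strict Implicit.
Unset Printing Implicit Defensive.
Import Order.TTheory GRing.Theory Num.Theory.
Local Open Scope ring_scope.

Lemma horner_taylor1 (R : comNzRingType) (F : {poly R}) (x h : R) :
  exists c, F.[x + h] = F.[x] + F^`().[x] * h + h ^+ 2 * c.
Proof.
elim/poly_ind: F => [|F a [c IH]].
  by exists 0; rewrite deriv0 !horner0; ring.
exists (F^`().[x] + c * (x + h)).
by rewrite derivD derivM derivX derivC !hornerE IH; ring.
Qed.

Lemma risingS (R : pzRingType) (x : R) (k : nat) :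
  rising x k.+1 = rising x k * (x + k%:R).
Proof. by rewrite /rising big_nat_recr. Qed.

Lemma rising_natr (R : pzRingType) (b k : nat) :
  rising (b.+1%:R : R) k = (k`! * 'C(b + k, k))%:R.
Proof.
elim: k => [|k IHk]; first by rewrite /rising big_nil bin0.
rewrite risingS IHk -natrD -natrM; congr (_ %:R).
rewrite addSn mulnAC -mulnA (mul_bin_diag (b + k).+1) addnS factS.
by rewrite mulnCA mulnA.
Qed.

Lemma rising_oppr_natr (R : pzRingType) (n k : nat) :
  rising (- n%:R : R) k = (-1) ^+ k * (n ^_ k)%:R.
Proof.
elim: k => [|k IHk]; first by rewrite /rising big_nil ffactn0 mulr1.
rewrite risingS IHk ffactnSr natrM exprSr -!mulrA; congr (_ * _).
(* For k > n the truncated n - k is no longer the ring difference, but both sides vanish since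
   [n ^_ k] is 0. *)
rewrite mulN1r -mulrN; case: (leqP k n) => [kn|nk].
  by rewrite natrB // opprB addrC.
by rewrite ffact_small // !mul0r.
Qed.

(** Reversing the product turns each factor into minus a factor of [rising x b]. For odd b and m
    this is the antisymmetry of G. *)
Lemma rising_reflect (R : comPzRingType) (x : R) (b : nat) :
  rising (1 - x - b%:R) b = (-1) ^+ b * rising x b.
Proof.
rewrite /rising big_nat_rev /= -[in (-1) ^+ _](subn0 b) -prodr_const_nat.
rewrite -big_split /=; apply: eq_big_nat => i /andP[_ ib].
by rewrite natrB // -nat1r; ring.
Qed.

Lemma horner_rising (R : comNzRingType) (f : {poly R}) (k : nat) (x : R) :
  (rising f k).[x] = rising f.[x] k.
Proof.
elim: k => [|k IHk]; first by rewrite /rising !big_nil hornerC.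
by rewrite !risingS hornerM IHk hornerD -polyC_natr hornerC.
Qed.

Lemma coprime_fact (p k : nat) : prime p -> (k < p)%N -> coprime p k`!.
Proof.
move=> p_prime; elim: k => [|k IHk] kp; first exact: coprimen1.
by rewrite factS coprimeMr IHk ?(ltnW kp) // prime_coprime // gtnNdvd.
Qed.

(** The differences (k+1)^(e+1) - k^(e+1) telescope to 0 over a full period. After binomial
    expansion, induction kills the powers below e, leaving e + 1, a unit mod p, times the wanted
    sum. *)
Lemma Fp_sum_exp (p e : nat) (p_prime : prime p) :
  (e < p.-1)%N -> \sum_(0 <= k < p) (k%:R : 'F_p) ^+ e = 0.
Proof.
have pchp := pchar_Fp p_prime.
elim/ltn_ind: e => e IHe ep.
have : \sum_(0 <= k < p) ((k.+1%:R : 'F_p) ^+ e.+1 - k%:R ^+ e.+1) = 0.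
  rewrite (telescope_sumr (fun k => (k%:R : 'F_p) ^+ e.+1)) //.
  by rewrite (pcharf0 pchp) subrr.
under eq_bigr => k _.
  rewrite -nat1r exprDn big_ord_recr /= subnn expr0 mul1r binn mulr1n.
  rewrite addrK.
  over.
rewrite exchange_big /= big_ord_recr /= big1 => [|i _]; last first.
  under eq_bigr do rewrite expr1n mul1r.
  by rewrite sumrMnl IHe ?mul0rn // (ltn_trans (ltn_ord i)).
under eq_bigr do rewrite expr1n mul1r.
rewrite add0r sumrMnl binSn -mulr_natr => /eqP; rewrite mulf_eq0 => /orP[/eqP//|].
by rewrite -(dvdn_pcharf pchp) gtnNdvd //; lia.
Qed.

(* The only power sum below degree 2p - 2 that survives mod p is that of
   'X^(p-1), and this monomial cannot occur in a derivative in
   characteristic p. *)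
Lemma Fp_sum_deriv (p : nat) (G : {poly 'F_p}) (p_prime : prime p) :
  (size G < (2 * p))%N -> \sum_(0 <= k < p) G^`().[k%:R] = 0.
Proof.
move=> sG; have p2 := prime_gt1 p_prime; have pchp := pchar_Fp p_prime.
under eq_bigr do rewrite horner_coef.
rewrite exchange_big /= big1 // => -[e /= eG] _.
have {}eG : (e < 2 * p.-1)%N.
  move: eG; case: (eqVneq G 0) => [->|G0]; first by rewrite deriv0 size_poly0.
  move/lt_size_deriv: G0 => sG' eG.
  by have := leq_ltn_trans (leq_ltn_trans eG sG') sG; lia.
rewrite -mulr_sumr; case: (ltngtP e p.-1) => ep.
- by rewrite Fp_sum_exp // mulr0.
(* Fermat's k^p = k lowers the exponent by p - 1, to a value strictly between 0 and p - 1. *)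
- under eq_bigr => k _.
    have -> : (k%:R : 'F_p) ^+ e = k%:R ^+ (e - p.-1).
      have {1}-> : e = ((e - p.-1).-1 + p)%N by lia.
      rewrite exprD -(pFrobenius_autE pchp) pFrobenius_aut_nat.
      by rewrite -exprSr; congr (_ ^+ _); lia.
    over.
  by rewrite Fp_sum_exp ?mulr0 //; lia.
- by rewrite coef_deriv ep prednK ?prime_gt0 // mulrn_pchar // mul0r.
Qed.

Lemma dvdz_sum_deriv (p : nat) (G : {poly int}) (p_prime : prime p) :
  (size G < (2 * p))%N -> (p %| \sum_(0 <= k < p) G^`().[k%:R])%Z.
Proof.
move=> sG; rewrite (dvdz_pcharf (pchar_Fp p_prime)) rmorph_sum /=; apply/eqP.
rewrite -[RHS](@Fp_sum_deriv p (map_poly intr G)) //; last first.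
  exact: leq_ltn_trans (size_poly _ _) sG.
apply: eq_bigr => k _.
by rewrite deriv_map -[k%:R in RHS](rmorph_nat intr) horner_map.
Qed.

(** The case t = 0, with b = 2a - 1. The bound on m * b is what makes deg G <= 2p - 3. *)
Lemma dvdn_sum_bin_exp (p b m : nat) (p_prime : prime p) (p_odd : odd p) :
    odd b -> odd m -> (2 < m)%N -> (m * b < 2 * p - 2)%N ->
  (p ^ 2 %| \sum_(0 <= k < p) 'C(b + k, k) ^ m)%N.
Proof.
move=> b_odd m_odd m2 mb; have p2 := prime_gt1 p_prime.
have bp : (b < p.-1)%N by nia.
pose G : {poly int} := rising ('X + 1) b ^+ m.
have GE x : G.[x] = rising (x + 1) b ^+ m.
  by rewrite horner_exp horner_rising !hornerE.
have sG : (size G < (2 * p))%N.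
  have sR : size (rising ('X + 1 : {poly int}) b) = b.+1.
    elim: (b) => [|j IHj]; first by rewrite /rising big_nil size_poly1.
    have XE : 'X + 1 + j%:R = 'X + (1 + j%:R)%:P :> {poly int}.
      by rewrite polyCD polyC_natr addrA.
    rewrite risingS XE size_Mmonic ?monicXaddC //; last first.
      by rewrite -size_poly_eq0 IHj.
    by rewrite size_XaddC IHj addn2.
  by apply: leq_ltn_trans (size_poly_exp_leq _ _) _; rewrite sR /= mulnC; lia.
have GnE k : G.[k%:R] = ((b`! * 'C(b + k, k)) ^ m)%N%:R.
  by rewrite GE natr1 rising_natr natrX -(bin_sub (leq_addl b k)) addnK addnC.
(* One of the factors of (k+1)_b is p. *)
have dp k : (p - b <= k < p)%N -> ((p ^ 2)%N %| G.[k%:R])%Z.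
  move=> kp; have ib : (k + b - p < b)%N by lia.
  rewrite GnE natz dvdzE !absz_nat -(bin_sub (leq_addl b k)) addnK mulnC bin_ffact.
  rewrite addnC ffact_prod (bigD1 (Ordinal ib)) //= subKn; last by lia.
  by rewrite expnMn dvdn_mulr // dvdn_exp2l // ltnW.
(* For k >= p - b, p^2 divides G(k), and G(k - p) is 0. For k < p - b, G(k) cancels against G(k' -
   p) with k' = p - b - 1 - k. *)
have symm : ((p ^ 2)%N %| \sum_(0 <= k < p) (G.[k%:R] + G.[k%:R - p%:R]))%Z.
  rewrite (@big_cat_nat _ _ _ (p - b)%N) ?leq_subr //=; apply: rpredD; last first.
    rewrite big_nat_cond; apply: rpred_sum => k; rewrite andbT => kp.
    apply: rpredD; first exact: dp.
    rewrite GE (_ : _ - _ + 1 = - (p.-1 - k)%N%:R); last by lia.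
    rewrite rising_oppr_natr ffact_small ?mulr0; last by lia.
    by rewrite expr0n eqn0Ngt (ltnW (ltnW m2)) dvdz0.
  rewrite big_split /= [X in _ + X]big_nat_rev -big_split /= big_nat_cond.
  apply: rpred_sum => k /andP[/andP[_ kp] _].
  rewrite !GE.
  have -> : (0 + (p - b) - k.+1)%N%:R - p%:R + 1 = 1 - (k%:R + 1) - b%:R :> int.
    by lia.
  rewrite rising_reflect exprMn -exprM -signr_odd oddM b_odd m_odd /= expr1.
  by rewrite mulN1r subrr dvdz0.
have shift k : ((p ^ 2)%N %| G.[k%:R - p%:R] - G.[k%:R] + p%:R * G^`().[k%:R])%Z.
  have [c ->] := horner_taylor1 G (k%:R) (- p%:R).
  apply/dvdzP; exists c; rewrite PoszM -[p%:Z]natz; ring.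
have {shift symm} : ((p ^ 2)%N %| 2 * \sum_(0 <= k < p) G.[k%:R])%Z.
  have -> : 2 * \sum_(0 <= k < p) G.[k%:R] =
      \sum_(0 <= k < p) (G.[k%:R] + G.[k%:R - p%:R])
      - \sum_(0 <= k < p) (G.[k%:R - p%:R] - G.[k%:R] + p%:R * G^`().[k%:R])
      + p%:R * \sum_(0 <= k < p) G^`().[k%:R].
    rewrite !mulr_sumr -sumrB -big_split; apply: eq_bigr => k _ /=; ring.
  apply: rpredD; last first.
    by rewrite natz PoszM; apply: dvdz_mul => //; exact: dvdz_sum_deriv.
  by apply: rpredB => //; apply: rpred_sum => k _.
have -> : \sum_(0 <= k < p) G.[k%:R] =
    (b`! ^ m * \sum_(0 <= k < p) 'C(b + k, k) ^ m)%N%:R.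
  by rewrite big_distrr natr_sum; apply: eq_bigr => k _; rewrite GnE expnMn.
(* The factors 2 and b!^m are prime to p, as p is odd and b < p. *)
rewrite -natrM natz dvdzE !absz_nat !Gauss_dvdr //.
  by rewrite coprimeXl // coprimeXr // coprime_fact //; lia.
by rewrite coprimeXl // coprimen2.
Qed.

(** The case t = -1, with n = p - 2a; here the sum is exactly 0, not just 0 mod p^2. *)
Lemma sum_rising_opp_exp (p n m : nat) (p_prime : prime p) (p_odd : odd p) :
    odd n -> odd m -> (n < p)%N ->
  \sum_(0 <= k < p) rising (- n%:R : padic p) k ^+ m / k`!%:R ^+ m = 0.
Proof.
move=> n_odd m_odd np.
have m_gt0 : (0 < m)%N by case: (m) m_odd.
have two_unit : (2%:R : padic p) \is a GRing.unit.
  by rewrite padic_natr_unit // coprimen2.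
have -> : \sum_(0 <= k < p) rising (- n%:R : padic p) k ^+ m / k`!%:R ^+ m =
    \sum_(0 <= k < n.+1) (-1) ^+ k * 'C(n, k)%:R ^+ m.
  rewrite (@big_cat_nat _ _ _ n.+1) //= [X in _ + X]big_nat_cond.
  rewrite [X in _ + X]big1 => [|k /andP[/andP[nk _] _]]; last first.
    by rewrite rising_oppr_natr ffact_small // mulr0 expr0n eqn0Ngt m_gt0 mul0r.
  rewrite addr0; apply: eq_big_nat => k /andP[_ kn].
  rewrite rising_oppr_natr -bin_ffact natrM mulrA exprMn mulrK.
    by rewrite exprMn -exprM mulnC exprM -(signr_odd _ m) m_odd expr1.
  by rewrite unitrX // padic_fact_unit // (leq_trans kn).
set S := \sum_(_ <= _ < _) _.
(* The symmetry k -> n - k flips the sign because n is odd, and 2 is invertible. *)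
suff SN : S = - S.
  apply: (mulrI two_unit); rewrite mulr0 mulr_natl mulr2n [X in X + _]SN.
  exact: addNr.
rewrite {1}/S big_nat_rev -sumrN; apply: eq_big_nat => k /andP[_ kn] /=.
rewrite add0n subSS bin_sub // -mulNr; congr (_ * _).
by rewrite -signr_odd oddB // n_odd -[in RHS]signr_odd; case: (odd k); rewrite ?opprK.
Qed.

Theorem theorem1 (p : nat) (p_prime : prime p) (p_odd : odd p)
    (r : nat) (r_ge1 : (1 <= r)%N) (alpha : padic p)
    (h_alpha : exists a : int,
      [/\ 1 <= a,
          (a%:~R : rat) < (p + r)%:R / (2 * r + 1)%:R
        & cong_mod (p%:R : padic p) alpha (2 * a)%:~R]) :
  cong_mod ((p ^ 2)%:R : padic p)
    (hypergeom (fun _ : 'I_(2 * r).+1 => alpha) (fun _ : 'I_(2 * r) => 1)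
       1 p.-1)
    0.
Proof.
case: h_alpha => -[a|a] [a1 ab [t tE]]; last by [].
have p2 := prime_gt1 p_prime.
have {}ab : (a * (2 * r + 1) < p + r)%N.
  move: ab; rewrite ltr_pdivlMr ?ltr0n ?addn1 //.
  by rewrite -pmulrn -natrM ltr_nat.
case: a a1 ab tE => [|a] a1 ab tE; first by [].
(* The a of the statement is now [a.+1], so [b] is 2a - 1 and [b.+1] is 2a in the original
   notation. *)
pose b := a.*2.+1; pose m := (2 * r).+1.
have b_odd : odd b by rewrite /= odd_double.
have m_odd : odd m by rewrite /= mul2n odd_double.
(* Doubling [ab] and subtracting m = 2r + 1 gives m * b <= 2p - 3. *)
have mb : (m * b < 2 * p - 2)%N by rewrite /m /b; nia.
have m2 : (2 < m)%N by rewrite /m; lia.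
have bp : (b < p.-1)%N by nia.
have alphaE : alpha = p%:R * t + b.+1%:R.
  rewrite -tE (_ : (2 * a.+1)%:~R = b.+1%:R :> padic p) ?subrK //.
  by rewrite (_ : 2 * a.+1 = b.+1%:R :> int) ?rmorph_nat // /b; lia.
rewrite hypergeom_const prednK ?prime_gt0 // -/m.
under eq_bigr do rewrite rising1.
pose F : {poly padic p} :=
  \sum_(0 <= k < p) rising ('X + b.+1%:R%:P) k ^+ m * ((k`!%:R ^+ m)^-1)%:P.
have FE x : F.[x] = \sum_(0 <= k < p) rising (x + b.+1%:R) k ^+ m / k`!%:R ^+ m.
  rewrite horner_sum; apply: eq_bigr => k _.
  by rewrite hornerM horner_exp horner_rising !hornerE.
have [d F0] : exists d, F.[0] = p%:R ^+ 2 * d.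
  have /dvdnP[d dE] := dvdn_sum_bin_exp p_prime p_odd b_odd m_odd m2 mb.
  exists d%:R; rewrite FE add0r -natrX -natrM mulnC -dE natr_sum.
  apply: eq_big_nat => k /andP[_ kp].
  rewrite rising_natr natrM exprMn mulrC mulKr ?natrX //.
  by rewrite unitrX // padic_fact_unit.
have Fp : F.[- p%:R] = 0.
  rewrite FE (_ : - p%:R + b.+1%:R = - (p - b.+1)%:R); last first.
    by rewrite natrB ?opprB 1?addrC //; lia.
  apply: sum_rising_opp_exp => //; last by lia.
  by rewrite oddB ?p_odd /= ?b_odd //; lia.
have [c cE] := horner_taylor1 F 0 (- p%:R).
have [c' c'E] := horner_taylor1 F 0 (p%:R * t).
(* Since F(-p) = 0 and F(0) = p^2 d, the expansion at -p gives p F'(0) = p^2 (d + c). Substituting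
   this in the expansion at pt yields the witness. *)
rewrite {1}alphaE -FE; exists (d + t * d + t * c + t ^+ 2 * c').
rewrite subr0 natrX -[p%:R * t]add0r c'E.
have FpE : F^`().[0] * p%:R = p%:R ^+ 2 * (d + c).
  move: cE; rewrite add0r Fp F0 => cE.
  by apply: subr0_eq; apply: oppr_inj; rewrite oppr0 [RHS]cE; ring.
by rewrite mulrA FpE F0; ring.
Qed.
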